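(* Let $S$ be a semigroup with finitely many $\mathcal{L}$-classes. If $S$ is f-noetherian, then $S$ is finitely generated (as a semigroup).
   Context: A right congruence on a semigroup $S$ is an equivalence relation $\rho$ on $S$ such that $(a,b)\in\rho$ implies $(as,bs)\in\rho$ for all $s\in S$. The right congruence generated by a set $X\subseteq S\times S$ is the smallest right congruence on $S$ containing $X$; a right congruence is finitely generated if it is generated by some finite set $X$. The index of an equivalence relation is the cardinality of its set of equivalence classes. A semigroup $S$ is f-noetherian if every right congruence of finite index on $S$ is finitely generated. Green's relation $\mathcal{L}$ on $S$ is given by $a\,\mathcal{L}\,b\iff S^1a=S^1b$, where $S^1$ is $S$ with an identity adjoined if necessary. *)

(* Defs.v *)
From HB Require Import structures.
From mathcomp Require Import all_boot.
From mathcomp Require Import boolp classical_sets functions cardinality.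

Set Implicit Arguments.
Unset Strict Implicit.
Unset Printing Implicit Defensive.

Local Open Scope group_scope.
Local Open Scope classical_set_scope.

(* Binary relations on T are sets of pairs, so that [smallest C X] is the
   relation with property C generated by X : set (T * T). *)
Definition equiv_relation (T : Type) (rho : set (T * T)) : Prop :=
  RelationClasses.Equivalence (fun a b => rho (a, b)).

Definition eq_classes (T : Type) (rho : set (T * T)) : set (set T) :=
  [set [set b | rho (a, b)] | a in [set: T]].

Definition finite_index (T : Type) (rho : set (T * T)) : Prop :=
  finite_set (eq_classes rho).

Definition right_congruence (S : semigroupType) (rho : set (S * S)) : Prop :=
  equiv_relation rho /\
  forall a b s : S, rho (a, b) -> rho (a * s, b * s).

Definition generated_right_congruence (S : semigroupType) (X : set (S * S)) :
    set (S * S) :=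
  smallest (@right_congruence S) X.

Definition fg_right_congruence (S : semigroupType) (rho : set (S * S)) : Prop :=
  exists2 X : set (S * S), finite_set X & rho = generated_right_congruence X.

Definition f_noetherian (S : semigroupType) : Prop :=
  forall rho : set (S * S),
    right_congruence rho -> finite_index rho -> fg_right_congruence rho.

Definition has_identity (S : semigroupType) : Prop :=
  exists e : S, forall x : S, e * x = x /\ x * e = x.

(* [None] plays the role of the adjoined identity. *)
Definition adjoin_mul (S : semigroupType) (u v : option S) : option S :=
  match u, v with
  | Some x, Some y => Some (x * y)
  | Some x, None => Some x
  | None, v => v
  end.

(* The carrier of S^1: the identity [None] is adjoined only if S has none. *)
Definition monoid_completion (S : semigroupType) : set (option S) :=
  [set u | u = None -> ~ has_identity S].
Arguments monoid_completion S : clear implicits.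

(* The principal left ideal S^1 a, as a subset of S^1. *)
Definition principal_left_ideal (S : semigroupType) (a : S) : set (option S) :=
  [set adjoin_mul u (Some a) | u in monoid_completion S].

Definition greenL (S : semigroupType) : set (S * S) :=
  [set ab | principal_left_ideal ab.1 = principal_left_ideal ab.2].
Arguments greenL S : clear implicits.

Definition subsemigroup (S : semigroupType) (A : set S) : Prop :=
  forall x y : S, A x -> A y -> A (x * y).

Definition fg_semigroup (S : semigroupType) : Prop :=
  exists2 X : set S, finite_set X & smallest (@subsemigroup S) X = [set: S].

(* Main.v *)
Require Import Defs.
From mathcomp Require Import all_boot.
From mathcomp Require Import boolp classical_sets functions cardinality.

(** The key remark is that Green's relation [L] is itself a right congruence,
and that having finitely many [L]-classes means that it has finite index. So an
f-noetherian [S] has a finite set [X] of pairs generating [L].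

Each pair [(a, b)] of [X] is [L]-related, hence [a = b] or [b = t * a] for some
multiplier [t], and likewise backwards. Let [T] be a subsemigroup containing one
multiplier in each direction for every pair of [X]. The relation ``each of [a]
and [b] is obtained from the other by an optional left multiplication by an
element of [T]'' is a right congruence ([mutually_reachable_right_congruence]):
left multipliers do not interfere with right translations. Since it contains
[X], it contains [L]: left multipliers from [T] are enough to move inside any
[L]-class ([greenL_finite_multipliers]).

If [T] also contains a representative [r] of every [L]-class, then every [a] is
[L]-related to some [r], so that [a = r] or [a = t * r] with [t] in [T]; hence
[T] is the whole of [S]. As finitely many multipliers and representatives
suffice, [T] can be taken finitely generated. *)

Set Implicit Arguments.
Unset Strict Implicit.
Unset Printing Implicit Defensive.

Local Open Scope group_scope.
Local Open Scope classical_set_scope.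

(** Representatives are chosen by a function on all sets, so the empty set needs
a default value; [T] may be empty, hence the choice of values in [option T]. *)
Lemma finite_transversal (T : Type) (rho : set (T * T)) :
  equiv_relation rho -> finite_index rho ->
  exists2 R : set T, finite_set R & forall a, exists2 r, R r & rho (a, r).
Proof.
move=> [rho_refl _ _] fin.
have pick (C : set T) : exists o : option T,
    C !=set0 -> exists2 r, o = Some r & C r.
  have [[r Cr]|C0] := pselect (C !=set0); last by exists None.
  by exists (Some r) => _; exists r.
have [f fP] := choice pick.
exists (Some @^-1` (f @` eq_classes rho)).
  apply: finite_preimage; last exact: finite_image.
  by move=> x y _ _ [].
move=> a; have [|r fr ar] := fP [set b | rho (a, b)].
  by exists a; exact: rho_refl.
by exists r => //; exists [set b | rho (a, b)] => //; exists a.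
Qed.

Lemma smallest_subsemigroup (S : semigroupType) (G : set S) :
  subsemigroup (smallest (@subsemigroup S) G).
Proof.
move=> x y Tx Ty A AP; exact: AP.1 (Tx A AP) (Ty A AP).
Qed.

(** Membership of [a] in [T^1 b], without adjoining an identity to [T]. *)
Definition reachable (S : semigroupType) (T : set S) (a b : S) : Prop :=
  a = b \/ exists2 t, T t & a = t * b.

Definition mutually_reachable (S : semigroupType) (T : set S) : set (S * S) :=
  [set ab | reachable T ab.1 ab.2 /\ reachable T ab.2 ab.1].

Lemma reachable_trans (S : semigroupType) (T : set S) (a b c : S) :
  subsemigroup T -> reachable T a b -> reachable T b c -> reachable T a c.
Proof.
move=> subT [->//|[t Tt ->]] [<-|[u Tu ->]]; right; first by exists t.
by exists (t * u); [exact: subT | rewrite mulgA].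
Qed.

Lemma reachable_mulr (S : semigroupType) (T : set S) (a b s : S) :
  reachable T a b -> reachable T (a * s) (b * s).
Proof.
by move=> [->|[t Tt ->]]; [left | right; exists t; rewrite ?mulgA].
Qed.

Lemma mutually_reachable_right_congruence (S : semigroupType) (T : set S) :
  subsemigroup T -> right_congruence (mutually_reachable T).
Proof.
move=> subT; split; last by move=> a b s [ab ba]; split; exact: reachable_mulr.
split=> [a|a b [ab ba]|a b c [/= ab ba] [/= bc cb]]; split=> //=; try by left.
- exact: reachable_trans bc.
- exact: reachable_trans ba.
Qed.

Lemma mem_principal_left_ideal (S : semigroupType) (a : S) :
  principal_left_ideal a (Some a).
Proof.
(* [None] is available as a multiplier only if [S] has no identity of its own. *)
have [[e eP]|noid] := pselect (has_identity S); last by exists None.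
by exists (Some e) => //=; rewrite (eP a).1.
Qed.

Lemma reachable_principal_left_ideal (S : semigroupType) (a b : S) :
  reachable [set: S] a b <->
  principal_left_ideal a `<=` principal_left_ideal b.
Proof.
split=> [[->//|[t _ ->]] _ [u _ <-]|].
  by case: u => [u|]; [exists (Some (u * t)) | exists (Some t)];
    rewrite //= mulgA.
move=> /(_ _ (mem_principal_left_ideal a)) [[t|] _ /= []] <-; last by left.
by right; exists t.
Qed.

Lemma greenLE (S : semigroupType) : greenL S = mutually_reachable [set: S].
Proof.
apply/seteqP; split=> -[a b] /=; rewrite /greenL /mutually_reachable /=.
  by move=> eqab; split; apply/reachable_principal_left_ideal; rewrite eqab.
by move=> [/reachable_principal_left_ideal ab /reachable_principal_left_ideal ba];
  apply/seteqP.
Qed.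

Lemma greenL_right_congruence (S : semigroupType) : right_congruence (greenL S).
Proof. by rewrite greenLE; exact: mutually_reachable_right_congruence. Qed.

(** Finite generation of [L] as a right congruence gives finite generation of
the left multipliers realising [L]. The multipliers are chosen pairwise from a
finite set [X] of generators of [L]; they generate enough because reachability
from any subsemigroup is compatible with right translations. *)
Lemma greenL_finite_multipliers (S : semigroupType) :
  fg_right_congruence (greenL S) ->
  exists2 U : set S, finite_set U &
    forall T, subsemigroup T -> U `<=` T -> greenL S `<=` mutually_reachable T.
Proof.
move=> [X finX genX].
have multiplier (p : S * S) : exists t : S,
    reachable [set: S] p.1 p.2 -> reachable [set t] p.1 p.2.
  have [[t tP]|no] := pselect (exists t, p.1 = t * p.2).
    by exists t => _; right; exists t.
  (* Here [p.1] is an arbitrary value: the only case left is [p.1 = p.2]. *)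
  by exists p.1 => -[->|[t _ tP]]; [left | case: no; exists t].
have [f fP] := choice multiplier.
have reach (T : set S) a b :
    T (f (a, b)) -> reachable [set: S] a b -> reachable T a b.
  by move=> Tf /(fP (a, b)) [/= ->|[_ -> /= ->]]; [left | right; exists (f (a, b))].
exists (f @` X `|` (fun p => f (p.2, p.1)) @` X).
  by rewrite finite_setU; split; exact: finite_image.
move=> T subT UT; rewrite genX.
apply: smallest_sub; first exact: mutually_reachable_right_congruence.
move=> [a b] Xab.
have : greenL S (a, b) by rewrite genX; exact: sub_gen_smallest.
rewrite greenLE => -[ab ba]; split; apply: reach => //; apply: UT.
- by left; exists (a, b).
- by right; exists (a, b).
Qed.

Theorem proposition4p2 (S : semigroupType)
    (finL : finite_set (eq_classes (greenL S)))
    (noethS : f_noetherian S) :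
  fg_semigroup S.
Proof.
have congL := greenL_right_congruence S.
have [U finU UP] := greenL_finite_multipliers (noethS _ congL finL).
have [R finR RP] := finite_transversal congL.1 finL.
exists (U `|` R); first by rewrite finite_setU.
set T := smallest _ _.
have subT : subsemigroup T by exact: smallest_subsemigroup.
have URT : U `|` R `<=` T by exact: sub_gen_smallest.
apply/seteqP; split=> // a _.
have [r Rr ar] := RP a.
have Tr : T r by apply: URT; right.
have [[/= ->//|[t Tt /= ->]] _] := UP T subT (fun x Ux => URT x (or_introl Ux)) _ ar.
exact: subT.
Qed.
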